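(* Let $X$ be a compact metrizable space which is an absolute neighborhood retract (ANR). Then $X$ is $e$-closed.
   Context: ''Space'' means compact metrizable space and ''map'' means continuous function. A space pair is a pair $(Y,Z)$ where $Y$ is a space and $Z\subseteq Y$ is a closed subspace. For spaces $X,Z$, $X^Z$ denotes the set of maps from $Z$ to $X$ with the topology of uniform convergence (equivalently, the compact-open topology). For a space pair $(Y,Z)$, $X^{Z\uparrow Y}\subseteq X^Z$ denotes the set of maps from $Z$ to $X$ which extend to a map from $Y$ to $X$. A space $X$ is $e$-closed if, for every space pair $(Y,Z)$, the set $X^{Z\uparrow Y}$ is closed in $X^Z$. A compact metrizable space $X$ is an ANR if, for every space pair $(Y,Z)$, every map from $Z$ to $X$ extends to a continuous map from some neighborhood of $Z$ in $Y$ to $X$. *)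

(* Defs.v *)
From HB Require Import structures.
From mathcomp Require Import all_boot all_order all_algebra.
From mathcomp Require Import all_classical all_reals all_analysis.

Set Implicit Arguments.
Unset Strict Implicit.
Unset Printing Implicit Defensive.

Local Open Scope classical_set_scope.

(* Compact metrizable spaces are represented by a [metricType R], i.e. with a
   chosen compatible metric, satisfying [compact [set: _]]; the empty space is
   allowed.  A closed subspace [Z : set Y] used as a type is the subtype
   [set_type Z] with its subspace topology. *)

Definition space_pair (R : realType) (Y : metricType R) (Z : set Y) : Prop :=
  compact [set: Y] /\ closed Z.

(* [X^Z]: the continuous functions only, topologized as a subspace of all
   functions under uniform convergence. *)
Definition map_space (Z : topologicalType) (X : uniformType) : uniformType :=
  initial_topology (fun f : continuousType Z X => (f : {uniform Z -> X})).

(* [X^{Z \uparrow Y}] *)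
Definition extendable_maps (R : realType) (X Y : metricType R) (Z : set Y) :
    set (map_space Z X) :=
  [set f : continuousType Z X |
    exists g : continuousType Y X, forall z : Z, g (set_val z) = f z].

Definition e_closed (R : realType) (X : metricType R) : Prop :=
  forall (Y : metricType R) (Z : set Y),
    space_pair Z -> closed (@extendable_maps R X Y Z).

(* The extension is a function on the subtype [U], not on [Y]: when [X] is
   empty and [Y] is not, there is no function from [Y] to [X]. *)
Definition ANR (R : realType) (X : metricType R) : Prop :=
  forall (Y : metricType R) (Z : set Y), space_pair Z ->
  forall f : continuousType Z X,
  exists (U : set Y) (g : continuousType U X),
    Z `<=` interior U /\
    forall (z : Z) (u : U), set_val u = set_val z -> g u = f z.

(* Main.v *)
Require Import Defs.
From HB Require Import structures.
From mathcomp Require Import all_boot all_order all_algebra.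
From mathcomp Require Import all_classical all_reals all_analysis.
From mathcomp Require Import ring.

(** An ANR [X] lets nearby maps be joined by a homotopy, and a homotopy can be
    used to push an extension of one map onto the other.

    The first half is [ANR_local_paths].  On the compact space
    [X * X * [0, 1]], the assignment (x, y, 0) |-> x, (x, y, 1) |-> y,
    (x, x, t) |-> x is continuous on a closed set; the ANR property extends it
    to a neighborhood, and compactness makes that neighborhood contain all
    (x, y, t) with x and y at distance less than some uniform e > 0.  The
    extension [L] provides a path t |-> L (x, y, t) from x to y that depends
    continuously on the pair (x, y) as long as x and y are e-close.

    The second half is [near_extendable].  Let [f] on [Z] be close to [g] which
    is defined on all of [Y].  By the ANR property again, [f] extends to a map
    [F] on a neighborhood of [Z], and near [Z] this [F] remains e-close to [g].
    A Urysohn function [u] that vanishes on [Z] and equals 1 away from [Z]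
    then interpolates: y |-> L (F y, g y, u y) is [f] on [Z] and turns into
    [g] before [F] stops being defined.  Hence every map uniformly e-close to
    an extendable one is extendable, with e depending on [X] alone, and the
    set of extendable maps contains its closure. *)

Set Implicit Arguments.
Unset Strict Implicit.
Unset Printing Implicit Defensive.

Import Order.TTheory GRing.Theory Num.Theory.
Import numFieldNormedType.Exports.

Local Open Scope classical_set_scope.
Local Open Scope ring_scope.

(** * Metrics on products and subspaces *)

Section metric_prod.
Context {R : realType} (M N : metricType R).
Implicit Types p q : M * N.

(* The maximum is forced: the ball of the product is the product of balls. *)
Let dist p q : R := Num.max (mdist p.1 q.1) (mdist p.2 q.2).

Let dist_ge0 p q : 0 <= dist p q.
Proof. by rewrite le_max mdist_ge0. Qed.

Let dist_positivity p q : dist p q = 0 -> p = q.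
Proof.
move=> d0; have := lexx (dist p q).
rewrite {2}d0 ge_max => /andP[d1 d2].
rewrite [p]surjective_pairing [q]surjective_pairing.
congr pair; apply: (@mdist_positivity R); apply/eqP;
  by rewrite eq_le mdist_ge0 andbT.
Qed.

Let ballEdist p (e : R) : ball p e = [set q | dist p q < e].
Proof.
apply/seteqP; split=> q /=; rewrite /dist gt_max.
  by move=> [] /=; rewrite !ballEmdist/= => -> ->.
by move=> /andP[? ?]; split; rewrite ballEmdist.
Qed.

HB.instance Definition _ :=
  PseudoMetric_isMetric.Build R (M * N)%type dist_ge0 dist_positivity ballEdist.
End metric_prod.

Section metric_set_type.
Context {R : realType} (M : metricType R) (A : set M).
Implicit Types a b : A.

Let dist a b : R := mdist (set_val a) (set_val b).

Let dist_ge0 a b : 0 <= dist a b.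
Proof. exact: mdist_ge0. Qed.

Let dist_positivity a b : dist a b = 0 -> a = b.
Proof. by move/mdist_positivity/val_inj. Qed.

Let ballEdist a (e : R) : ball a e = [set b | dist a b < e].
Proof. by rewrite -initial_ballE ballEmdist. Qed.

HB.instance Definition _ :=
  PseudoMetric_isMetric.Build R A dist_ge0 dist_positivity ballEdist.
End metric_set_type.

(** * Absolute neighborhood retracts *)

Lemma closed_diagonal (T : topologicalType) :
  hausdorff_space T -> closed [set p : T * T | p.1 = p.2].
Proof.
move=> hT [x y] cxy; apply: hT => A B Ax By.
have nAB : nbhs (x, y) (A `*` B) by exists (A, B).
have [[a b] [/= <- [Aa Bb]]] := cxy _ nAB.
by exists a.
Qed.

(** The ANR property for total functions: the given [f : Y -> X] provides the
    values outside the neighborhood, so that the extension need not live on a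
    subtype. *)
Lemma ANR_extend_nbhs (R : realType) (X Y : metricType R) (Z : set Y)
    (f : Y -> X) :
  ANR X -> space_pair Z -> {within Z, continuous f} ->
  exists (U : set Y) (g : Y -> X),
    [/\ open U, Z `<=` U, {in U, continuous g} & {in Z, g =1 f}].
Proof.
move=> hX YZ /subspace_sigL_continuousP cf.
have [U [g [ZU gf]]] := hX Y Z YZ (mkcts cf).
pose h y := if pselect (U y) is left Uy then g (SigSub (mem_set Uy)) else f y.
have hE (u : U) : h (set_val u) = g u.
  rewrite /h; case: pselect => [Uu|]; last by case; exact: set_valP.
  by congr (g _); exact: val_inj.
exists U°, h; split=> //.
- exact: open_interior.
- rewrite -continuous_open_subspace; last exact: open_interior.
  apply: (@continuous_subspaceW _ _ _ U); first exact: interior_subset.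
  apply/subspace_sigL_continuousP.
  rewrite (_ : sigL U h = g); first exact: cts_fun.
  by apply/funext => u; rewrite /sigL/= hE.
- move=> z /set_mem Zz.
  have Uz : U z by apply: interior_subset; exact: ZU.
  by have := gf (SigSub (mem_set Zz)) (SigSub (mem_set Uz)) erefl; rewrite -hE.
Qed.

(** The regular module [R^o] is the copy of [R] that carries the metric. *)
Definition unit_interval (R : realType) : set R^o := `[0, 1].
Arguments unit_interval : clear implicits.

Lemma clamp_subproof (R : realType) (t : R) :
  Num.max 0 (Num.min 1 t) \in unit_interval R.
Proof.
by rewrite inE /unit_interval /= in_itv/= le_max lexx ge_max ge_min lexx ler01.
Qed.

(** The retraction of the line onto [0, 1].  It shows that the subtype is compact
    and lets paths be parametrized by all real numbers. *)
Definition clamp (R : realType) (t : R) : unit_interval R :=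
  SigSub (clamp_subproof t).

Lemma clamp_continuous (R : realType) : continuous (@clamp R).
Proof.
apply: continuous_comp_initial => t.
have cmin : {for t, continuous ((cst 1 : R -> R^o) \min (idfun : R -> R^o))}.
  by apply: continuous_min; [exact: cvg_cst|exact: cvg_id].
by apply: (@continuous_max _ _ (cst 0)) cmin; exact: cvg_cst.
Qed.

Lemma set_val_clamp (R : realType) (t : R) :
  0 <= t <= 1 -> set_val (clamp t) = t.
Proof.
move=> /andP[t0 t1].
by rewrite -[LHS]/(Num.max 0 (Num.min 1 t)) min_r// max_r.
Qed.

Lemma unit_interval_compact (R : realType) : compact [set: unit_interval R].
Proof.
have -> : [set: unit_interval R] = @clamp R @` `[0, 1].
  apply/seteqP; split=> // s _; exists (set_val s); first exact: set_valP.
  apply: val_inj; rewrite /= -[RHS]set_val_clamp//.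
  by have := set_valP s; rewrite /unit_interval/= in_itv.
apply: continuous_compact; last exact: segment_compact.
exact/continuous_subspaceT/clamp_continuous.
Qed.

(** A tube lemma around the diagonal.  Openness of [U] at (x, x, t) gives a
    radius that serves all points near (x, t), so compactness of [X * K] gives
    a single one. *)
Lemma diagonal_tube (R : realType) (X : pseudoMetricType R)
    (K : topologicalType) (U : set (X * X * K)) :
  compact [set: X] -> compact [set: K] -> open U ->
  (forall x t, U (x, x, t)) ->
  exists2 e : R, 0 < e & forall x y t, ball x e y -> U (x, y, t).
Proof.
move=> cX cK oU dU.
have cXK : compact [set: X * K] by rewrite -setXTT; exact: compact_setX.
pose P (e : R) (p : X * K) := forall y, ball p.1 e y -> U (p.1, y, p.2).
have : \forall e \near 0^'+, [set: X * K] `<=` P e.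
  apply: (compact_near_coveringP _).1 => // -[x t] _.
  have [[V W] /= [Vxx Wt] VWU] : nbhs (x, x, t) U.
    by apply: open_nbhs_nbhs; split=> //; exact: dU.
  have [r /= r0 rV] : nbhs_ball (x, x) V by rewrite nbhs_ballE.
  (* Half of [r] is spent on moving [x], the other half on moving [y]. *)
  exists (ball x (r / 2) `*` W, [set e | 0 < e < r / 2]) => /=.
    split; last first.
      near=> e; apply/andP; split.
        near: e; exact: nbhs_right_gt.
      by near: e; apply: nbhs_right_lt; rewrite divr_gt0.
    exists (ball x (r / 2), W) => //; split => //.
    by apply: nbhsx_ballx; rewrite divr_gt0.
  move=> [[x' t'] e] /= [[xx' Wt'] /andP[e0 er]] y /= x'y.
  apply: (VWU (x', y, t')); split => //=; apply: rV; split => /=.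
    by apply: le_ball xx'; rewrite ler_pdivrMr// ler_peMr ?ler1n// ltW.
  rewrite [r]splitr; apply: ball_triangle xx' _.
  by apply: le_ball x'y; exact: ltW.
move=> eP; near (0 : R)^'+ => e.
have Pe : [set: X * K] `<=` P e by near: e.
have e0 : 0 < e by near: e; exact: nbhs_right_gt.
by exists e => // x y t; exact: (Pe (x, t) I).
Unshelve. all: by end_near. Qed.

(** Close points of a compact ANR are joined by paths depending continuously on
    their endpoints: the prescribed ends and the constant paths on the diagonal
    form a map on a closed subset of the space [X * X * [0, 1]], to which the
    ANR property applies. *)
Lemma ANR_local_paths (R : realType) (X : metricType R) :
  compact [set: X] -> ANR X ->
  exists2 e : R, 0 < e & exists L : X * X * R -> X,
    [/\ forall x y, L (x, y, 0) = x, forall x y, L (x, y, 1) = y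
      & forall x y (t : R), ball x e y -> {for (x, y, t), continuous L}].
Proof.
move=> cX hX.
pose I := unit_interval R; pose Y : metricType R := ((X * X) * I)%type.
have cY : compact [set: Y].
  rewrite -setXTT; apply: compact_setX; last exact: unit_interval_compact.
  by rewrite -setXTT; exact: compact_setX.
pose time (p : Y) : R^o := set_val p.2.
pose Z0 := [set p : Y | time p = 0]; pose Z1 := [set p : Y | time p = 1].
pose Zd := [set p : Y | p.1.1 = p.1.2].
pose f (p : Y) := if time p == 0 then p.1.1 else p.1.2.
have f0 p : time p = 0 -> f p = p.1.1 by rewrite /f => ->; rewrite eqxx.
have f1 p : time p = 1 -> f p = p.1.2 by rewrite /f => ->; rewrite oner_eq0.
have fd p : p.1.1 = p.1.2 -> f p = p.1.1 by rewrite /f => ->; case: ifP.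
have ctime : continuous time.
  move=> p; apply: (@continuous_comp Y I R^o snd set_val); first exact: cvg_snd.
  exact: initial_continuous.
have cfst : continuous (fun p : Y => p.1.1).
  by move=> p; apply: (@continuous_comp Y (X * X)%type X fst fst);
     exact: cvg_fst.
have csnd : continuous (fun p : Y => p.1.2).
  move=> p; apply: (@continuous_comp Y (X * X)%type X fst snd).
    exact: cvg_fst.
  exact: cvg_snd.
have cZ (c : R) : closed [set p | time p = c].
  move/continuous_closedP: ctime => /(_ [set x | x = c]); apply.
  exact: closed_eq.
have cZd : closed Zd.
  have cf1 : continuous (fst : Y -> X * X) by move=> p; exact: cvg_fst.
  move/continuous_closedP: cf1 => /(_ [set q : X * X | q.1 = q.2]); apply.
  exact: (closed_diagonal (@metric_hausdorff R X)).
have cZ01 : closed (Z0 `|` Z1) by apply: closedU; exact: cZ.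
have cf : {within Z0 `|` Z1 `|` Zd, continuous f}.
  apply: (withinU_continuous cZ01 cZd).
    apply: (withinU_continuous (cZ 0) (cZ 1)).
      apply: (@subspace_eq_continuous _ _ _ (fun p : Y => p.1.1)).
        by move=> p /set_mem p0; exact/esym/f0.
      exact: continuous_subspaceT.
    apply: (@subspace_eq_continuous _ _ _ (fun p : Y => p.1.2)).
      by move=> p /set_mem p1; exact/esym/f1.
    exact: continuous_subspaceT.
  apply: (@subspace_eq_continuous _ _ _ (fun p : Y => p.1.1)).
    by move=> p /set_mem pd; exact/esym/fd.
  exact: continuous_subspaceT.
have [|U [g [oU ZU cg gf]]] := @ANR_extend_nbhs R X Y _ f hX _ cf.
  by split=> //; exact: closedU.
have [|e e0 eU] := @diagonal_tube R X I U cX (@unit_interval_compact R) oU.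
  by move=> x t; apply: ZU; right.
exists e => //; exists (fun p => g (p.1, clamp p.2)); split.
- move=> x y; have v0 : time (x, y, clamp 0) = 0.
    by rewrite /time /= set_val_clamp// lexx ler01.
  by rewrite gf ?inE; [exact: f0|left; left].
- move=> x y; have v1 : time (x, y, clamp 1) = 1.
    by rewrite /time /= set_val_clamp// lexx ler01.
  by rewrite gf ?inE; [exact: f1|left; right].
- move=> x y t xy.
  have cc : {for (x, y, t),
      continuous (fun p : X * X * R => (p.1, clamp p.2))}.
    apply: (@cvg_pair _ _ _ _ (nbhs (x, y)) (nbhs (clamp t))).
      exact: cvg_fst.
    apply: (@cvg_comp _ _ _ _ _ _ (nbhs t)); first exact: cvg_snd.
    exact: clamp_continuous.
  apply: (@continuous_comp _ Y X _ g _ cc).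
  by apply: cg; rewrite inE; exact: eU.
Qed.

(** * Extending maps close to an extendable map *)

(** Along the path from [F y] to [g y] one moves from an extension [F] of [f]
    near [Z] to the global map [g]; the time is a Urysohn function.  The radius
    is obtained before [Y] and [Z] are chosen, as it comes from the paths in
    [X]. *)
Lemma near_extendable (R : realType) (X : metricType R) :
  compact [set: X] -> ANR X ->
  exists2 e : R, 0 < e &
    forall (Y : metricType R) (Z : set Y), space_pair Z ->
    forall f g : Y -> X, {within Z, continuous f} -> continuous g ->
      (forall z, Z z -> ball (f z) e (g z)) ->
    exists2 h : Y -> X, continuous h & {in Z, h =1 f}.
Proof.
move=> cX hX; have [e e0 [L [L0 L1 cL]]] := ANR_local_paths cX hX.
have e30 : 0 < e / 3 by rewrite divr_gt0.
(* One third is the distance of [f] to [g] on [Z]; the other two allow [F] and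
   [g] to vary when leaving [Z]. *)
exists (e / 3) => // Y Z YZ f g cf cg fg.
have [U [F [oU ZU cF Ff]]] := ANR_extend_nbhs hX YZ cf.
pose O := (U `&` [set y | ball (F y) e (g y)])°.
have ZO : Z `<=` O.
  move=> z Zz; apply: filterI.
    by apply: open_nbhs_nbhs; split=> //; exact: ZU.
  have Fz : F z = f z by apply: Ff; rewrite inE.
  have nF : \forall y \near z, ball (F z) (e / 3) (F y).
    exact: (cvg_ball (cF z (mem_set (ZU _ Zz))) e30).
  have ng : \forall y \near z, ball (g z) (e / 3) (g y).
    exact: (cvg_ball (cg z) e30).
  near=> y; rewrite /=; have -> : e = e / 3 + e / 3 + e / 3 by field.
  apply: (@ball_triangle _ _ (g z)); last by near: y.
  apply: (@ball_triangle _ _ (F z)); last by rewrite Fz; exact: fg.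
  by apply: ball_sym; near: y.
have clZ : closed Z by case: YZ.
(* The path formula is used on [closure C], inside [O] where it makes sense, and
   [g] is used on the complement of [C]; they agree where [u] is 1. *)
have [W /set_nbhsP[C [oC ZC CW]] WO] : exists2 W, set_nbhs Z W & closure W `<=` O.
  apply: (@pseudometric_normal R Y Z clZ); apply/set_nbhsP; exists O.
  by split=> //; exact: open_interior.
have CO : closure C `<=` O by apply: subset_trans WO; exact: closure_subset.
have [u [cu _ u0 u1]] : exists u : Y -> R,
    [/\ continuous u, range u `<=` `[0, 1],
    u @` Z `<=` [set 0] & u @` (~` C) `<=` [set 1]].
  apply/uniform_separatorP.
  apply: (@normal_separatorP R Y).1 => //; first exact: pseudometric_normal.
    exact: open_closedC.
  by apply/disjoints_subset; rewrite setCK.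
pose h y := if y \in closure C then L (F y, g y, u y) else g y.
have hC y : y \in closure C -> h y = L (F y, g y, u y) by rewrite /h => ->.
have hD y : ~ C y -> h y = g y.
  move=> Cy; rewrite /h; case: ifP => // _.
  by rewrite (u1 (u y)) ?L1//; exists y.
exists h.
  apply/continuous_subspace_setT.
  have -> : [set: Y] = closure C `|` ~` C.
    apply/esym/seteqP; split=> // y _.
    by have [Cy|] := pselect (C y); [left; exact: subset_closure|right].
  apply: withinU_continuous; first exact: closed_closure.
  - exact: open_closedC.
  - apply: (@subspace_eq_continuous _ _ _ (fun y => L (F y, g y, u y))).
      by move=> y yC; exact/esym/hC.
    apply: (@continuous_subspaceW _ _ _ O) => //.
    rewrite continuous_open_subspace; last exact: open_interior.
    move=> y /set_mem /interior_subset [Uy /= Fgy].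
    have cFgu : {for y, continuous (fun y => (F y, g y, u y))}.
      apply: (@cvg_pair _ _ _ _ (nbhs (F y, g y)) (nbhs (u y))); last exact: cu.
      apply: (@cvg_pair _ _ _ _ (nbhs (F y)) (nbhs (g y))); last exact: cg.
      by apply: cF; rewrite inE.
    by apply: (@continuous_comp _ _ X _ L _ cFgu); exact: cL.
  - apply: (@subspace_eq_continuous _ _ _ g); last exact: continuous_subspaceT.
    by move=> y /set_mem Cy; exact/esym/hD.
move=> z /[dup] zZ /set_mem Zz; rewrite hC; last exact/mem_set/subset_closure/ZC.
by rewrite (u0 (u z)) ?L0 ?Ff//; exists z.
Unshelve. all: by end_near. Qed.

Theorem theorem3p5 (R : realType) (X : metricType R)
  (hX : compact [set: X]) (hANR : ANR X) : e_closed X.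
Proof.
move=> Y Z YZ f clf.
have [e e0 ext] := near_extendable hX hANR.
have nf : nbhs f [set h : map_space Z X | forall z : Z, ball (f z) e (h z)].
  have : nbhs ((f : Z -> X) : {uniform Z -> X})
      [set h : {uniform Z -> X} | forall z : Z, ball (f z) e (h z)].
    apply/uniform_nbhs; exists [set xy | ball xy.1 e xy.2]; split.
      by rewrite -entourage_ballE; exists e.
    by move=> h /= H z; exact: H.
  exact: initial_continuous.
have [h [[g gh] fh]] := clf _ nf.
(* Any function on [Y] with values in [X] may fill in outside [Z]; here [g],
   since [X] has no distinguished point. *)
pose f' y := if pselect (Z y) is left Zy then f (SigSub (mem_set Zy)) else g y.
have f'E (z : Z) : f' (set_val z) = f z.
  rewrite /f'; case: pselect => [Zz|]; last by case; exact: set_valP.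
  by congr (f _); exact: val_inj.
have [|||k ck kf] := ext Y Z YZ f' g.
- apply/subspace_sigL_continuousP.
  rewrite (_ : sigL Z f' = f); first exact: cts_fun.
  by apply/funext => z; rewrite /sigL/= f'E.
- exact: cts_fun.
- move=> z Zz; have := fh (SigSub (mem_set Zz)).
  by rewrite -gh -f'E.
exists (mkcts ck) => z.
by rewrite -f'E; apply: kf; rewrite inE; exact: set_valP.
Qed.
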